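(* Let $k$ be a non-negative integer and let $t\in\{0,\ldots,k-1\}$ be even. Then \[ m_1(2k,k,t)\le 2\cdot\binom{2k-t-1}{k}=2\cdot\binom{2k-t-1}{k-t-1}. \]
   Context: For a finite set $V$ of size $n$, $\binom{V}{k}$ is the set of all $k$-element subsets of $V$. For $T\subseteq V$ with $\#T=t$, the $t$-pencil focussed at $T$ is the characteristic function of $\{K\in\binom{V}{k}\mid T\subseteq K\}$. The degree of a non-zero function $f:\binom{V}{k}\to\mathbb{R}$ is the smallest $t$ such that $f$ is an $\mathbb{R}$-linear combination of $t$-pencils; the degree of the zero function is $-\infty$. A function $f$ is Boolean if it takes only the values $0$ and $1$; its size is $\#f=\sum_{K}f(K)$. For non-negative integers $t$ and $k\le n$, $m_1(n,k,t)$ denotes the minimum size of a non-zero Boolean function $\binom{V}{k}\to\{0,1\}$ of degree at most $t$, where $\#V=n$. *)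

(* Defs.v *)
From HB Require Import structures.
From mathcomp Require Import all_boot all_order all_algebra.
From mathcomp Require Import reals.

Set Implicit Arguments.
Unset Strict Implicit.
Unset Printing Implicit Defensive.

Import Order.TTheory GRing.Theory Num.Theory.
Local Open Scope ring_scope.

Definition ksubset (V : finType) (k : nat) := {K : {set V} | #|K| == k}.

(* The codomain is R^o, i.e., R as a one-dimensional space over itself, so that
   the functions on k-subsets form a vectType over R. *)
Definition pencil (R : realType) (V : finType) (k : nat) (T : {set V}) :
    {ffun ksubset V k -> R^o} :=
  [ffun K : ksubset V k => (T \subset val K)%:R].

Definition pencil_comb (R : realType) (V : finType) (k t : nat)
    (f : {ffun ksubset V k -> R^o}) : bool :=
  f \in <<[seq pencil R k T | T : {set V} in [pred T : {set V} | #|T| == t]]>>%VS.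

Lemma pencil_comb_ex (R : realType) (V : finType) (k : nat)
  (f : {ffun ksubset V k -> R^o}) : exists t, pencil_comb t f.
Proof.
exists k; rewrite /pencil_comb.
have -> : f = \sum_(K : ksubset V k) f K *: pencil R k (val K).
  apply/ffunP => L; rewrite sum_ffunE (bigD1 L) //= !ffunE subxx.
  rewrite big1 => [|K neqKL]; first by rewrite addr0 /GRing.scale /= mulr1.
  rewrite !ffunE; case: (boolP (val K \subset val L)) => [sKL|_]; last first.
    by rewrite scaler0.
  case/negP: neqKL; rewrite -val_eqE eqEcard sKL.
  by rewrite (eqP (valP K)) (eqP (valP L)) leqnn.
apply: rpred_sum => K _; apply/rpredZ/memv_span/image_f.
exact: (valP K).
Qed.

(* None stands for the degree -oo of the zero function. *)
Definition degree (R : realType) (V : finType) (k : nat)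
    (f : {ffun ksubset V k -> R^o}) : option nat :=
  if f == 0 then None else Some (ex_minn (pencil_comb_ex f)).

Definition degree_le (d : option nat) (t : nat) : bool :=
  if d is Some s then (s <= t)%N else true.

Definition real_of_boolean (R : realType) (V : finType) (k : nat)
    (f : {ffun ksubset V k -> bool}) : {ffun ksubset V k -> R^o} :=
  [ffun K => (f K)%:R].

Definition bool_size (V : finType) (k : nat)
    (f : {ffun ksubset V k -> bool}) : nat := (\sum_K f K)%N.

Definition m1_admissible (R : realType) (n k t : nat)
    (f : {ffun ksubset 'I_n k -> bool}) : bool :=
  (real_of_boolean R f != 0) && degree_le (degree (real_of_boolean R f)) t.

(* The constant function 1 is only the default value that the arg min operator
   requires; it is admissible as soon as k <= n, see m1P. *)
Definition m1 (R : realType) (n k t : nat) : nat :=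
  bool_size [arg min_(f < [ffun=> true] : {ffun ksubset 'I_n k -> bool}
               | m1_admissible R t f) bool_size f]%N.

Lemma m1P (R : realType) (n k t : nat) : (k <= n)%N ->
  (exists2 f : {ffun ksubset 'I_n k -> bool},
     m1_admissible R t f & bool_size f = m1 R n k t) /\
  (forall f : {ffun ksubset 'I_n k -> bool},
     m1_admissible R t f -> (m1 R n k t <= bool_size f)%N).
Proof.
move=> le_kn; rewrite /m1.
have adm1 : m1_admissible R t ([ffun=> true] : {ffun ksubset 'I_n k -> bool}).
  have f1E : real_of_boolean R [ffun=> true] = pencil R k (set0 : {set 'I_n}).
    by apply/ffunP => K; rewrite !ffunE sub0set.
  have cardK : #|[set widen_ord le_kn i | i : 'I_k]| == k.
    rewrite card_imset ?card_ord // => i j /(congr1 val) /= ij.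
    exact: val_inj.
  rewrite /m1_admissible /degree; case: eqP => [|_] /=.
    move/ffunP/(_ (exist (fun K : {set _} => #|K| == k) _ cardK)); rewrite !ffunE => /eqP.
    by rewrite oner_eq0.
  case: ex_minnP => s _ min_s; apply: leq_trans (leq0n t); apply: min_s.
  by rewrite f1E; apply/memv_span/image_f; rewrite inE cards0.
by case: arg_minnP => // f Pf min_f; split=> //; exists f.
Qed.

(* Main.v *)
(** Let [T] have the odd cardinality [t + 1], and let [f] be the indicator of the
    [k]-subsets that contain [T] or are disjoint from [T].  By
    inclusion-exclusion the indicator of disjointness is the alternating sum of
    the pencils of all [J \subset T].  As [#|T|] is odd, the term [J = T] is
    minus the indicator of containing [T], so it cancels in [f], which therefore
    has degree at most [t].  Complementation exchanges the two kinds of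
    [k]-subsets of a [2k]-set. *)

Require Import Defs.
From mathcomp Require Import all_boot all_order all_algebra.
From mathcomp Require Import reals.
From mathcomp Require Import zify.

Set Implicit Arguments.
Unset Strict Implicit.
Unset Printing Implicit Defensive.

Import GRing.Theory Num.Theory.

Section Pencils.
Local Open Scope ring_scope.

Lemma prod_natr_bool (S : comNzRingType) (I : finType) (P Q : pred I) :
  \prod_(i | P i) (Q i)%:R = [forall (i | P i), Q i]%:R :> S.
Proof.
have [/forall_inP PQ|] := boolP [forall (i | P i), Q i].
  by rewrite big1 // => i /PQ ->.
by case/forall_inPn => i Pi /negPf Qi; rewrite (bigD1 i) //= Qi mul0r.
Qed.

Variables (R : realType) (V : finType) (k : nat).
Implicit Types (J T : {set V}) (f : {ffun ksubset V k -> R^o}).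

(** Double counting: a [k]-set [K] containing [J] contains [i |: J] for exactly the [k - #|J|]
    points [i] of [K :\: J]; any other [K] contributes 0 to both sides. *)
Lemma sum_pencilU1 J :
  \sum_(i in ~: J) pencil R k (i |: J) = (k - #|J|)%:R *: pencil R k J.
Proof.
apply/ffunP => K; rewrite sum_ffunE !ffunE.
under eq_bigr => i _ do rewrite ffunE subUset sub1set.
have [sJK|_] := boolP (J \subset val K); last first.
  by rewrite scaler0 big1 // => i _; rewrite andbF.
under eq_bigr => i _ do rewrite andbT.
rewrite -natr_sum -big_mkcondr /= sum1dep_card /GRing.scale /= mulr1.
rewrite -[in RHS](eqP (valP K)) -cardsDS //; congr _%:R.
by apply: eq_card => i; rewrite !inE.
Qed.

(** Induction on [t - #|J|]: while [#|J| < t <= k], the factor [k - #|J|] in [sum_pencilU1] is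
    invertible, so the pencil of [J] is a combination of pencils with one more point in the
    focus. *)
Lemma pencil_comb_pencil t J :
  (#|J| <= t)%N -> (t <= k)%N -> pencil_comb t (pencil R k J).
Proof.
move=> leJt le_tk; have [m] := ubnP (t - #|J|); elim: m J leJt => // m IHm J leJt ltm.
move: leJt; rewrite leq_eqVlt => /orP[cardJ|ltJt].
  exact/memv_span/image_f.
have kJ_neq0 : (k - #|J|)%:R != 0 :> R.
  by rewrite pnatr_eq0 subn_eq0 -ltnNge (leq_trans ltJt).
rewrite /pencil_comb -[pencil R k J](scalerK kJ_neq0) -sum_pencilU1.
apply/rpredZ/rpred_sum => i; rewrite inE => iJ.
by apply: IHm; rewrite cardsU1 iJ; lia.
Qed.

Lemma degree_leW t f : pencil_comb t f -> degree_le (degree f) t.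
Proof.
by rewrite /degree => ft; case: eqP => //= _; case: ex_minnP => s _; apply.
Qed.

Lemma sum_sign_pencil T K :
  \sum_(J in powerset T) ((-1) ^+ #|J| *: pencil R k J) K =
  [disjoint T & val K]%:R.
Proof.
(* Each factor is 1 minus the indicator that [i] lies in both [T] and [K]. *)
have -> : [disjoint T & val K]%:R =
    \prod_i ((i \in T)%:R * - (i \in val K)%:R + 1) :> R.
  rewrite disjoint_subset.
  have -> : (T \subset [predC val K]) =
      [forall i, (i \in T) ==> (i \notin val K)].
    by apply/subsetP/forall_inP => sTK i /sTK.
  rewrite -prod_natr_bool big_mkcond; apply: eq_bigr => i _.
  by case: (i \in T); case: (i \in val K); rewrite
    ?mul1r ?mul0r ?addNr ?oppr0 ?add0r.
(* Expand the product: [J] is the set of indices where the first summand is chosen, and its term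
   vanishes unless [J \subset T]. *)
rewrite bigA_distr; under [RHS]eq_bigr => J _ do rewrite -big_mkcond /=.
rewrite big_mkcond; apply: eq_bigr => J _; rewrite powersetE big_split /= prodrN.
rewrite !prod_natr_bool !ffunE.
have sub (A : {set V}) : [forall i in J, i \in A] = (J \subset A).
  by apply/forall_inP/subsetP.
by rewrite !sub; case: (J \subset T); rewrite ?mul1r ?mul0r.
Qed.

Definition full_or_disjoint T : {ffun ksubset V k -> bool} :=
  [ffun K : ksubset V k => (T \subset val K) || [disjoint T & val K]].

Lemma full_or_disjoint_sum T : odd #|T| ->
  real_of_boolean R (full_or_disjoint T) =
  \sum_(J in powerset T | J != T) (-1) ^+ #|J| *: pencil R k J.
Proof.
move=> oddT; have T0 : T != set0 by apply: contraTneq oddT => ->; rewrite cards0.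
apply/ffunP => K; rewrite sum_ffunE !ffunE.
have := sum_sign_pencil T K; rewrite (bigD1 T) ?powersetE //= => /(canRL (addKr _)) ->.
rewrite !ffunE -signr_odd oddT expr1 scaleN1r opprK.
(* Since [T] is nonempty, the two alternatives exclude each other and their indicators add up. *)
have [sTK|_] := boolP (T \subset val K); last by rewrite add0r.
by rewrite -setI_eq0 (setIidPl sTK) (negPf T0) addr0.
Qed.

Lemma full_or_disjoint_comb t T : odd #|T| -> (#|T| = t.+1)%N -> (t <= k)%N ->
  pencil_comb t (real_of_boolean R (full_or_disjoint T)).
Proof.
move=> oddT cardT le_tk; rewrite full_or_disjoint_sum //.
apply: rpred_sum => J /andP[]; rewrite powersetE => sJT neJT.
apply: rpredZ; apply: pencil_comb_pencil => //.
by rewrite -ltnS -cardT proper_card // properEneq neJT.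
Qed.

End Pencils.

Section Size.
Variables (V : finType) (k : nat).

Lemma sum_ksubset (P : pred {set V}) :
  \sum_(K : ksubset V k) P (val K) = #|[set A | P A & #|A| == k]|.
Proof.
rewrite -big_mkcond sum1dep_card -(card_imset _ val_inj); apply: eq_card => A.
rewrite inE; apply/imsetP/andP => [[K]|[PA cardA]].
  by rewrite inE => PK ->; split=> //; apply: valP K.
by exists (exist (fun B : {set V} => #|B| == k) A cardA); rewrite ?inE.
Qed.

Lemma size_full_or_disjoint (T : {set V}) : #|V| = 2 * k -> T != set0 ->
  bool_size (full_or_disjoint k T) = 2 * 'C(#|V| - #|T|, k).
Proof.
move=> cardV T0; pose D := [set A : {set V} | A \subset ~: T & #|A| == k].
have cardD : #|D| = 'C(#|V| - #|T|, k) by rewrite cards_draws cardsCs setCK.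
rewrite /bool_size; under eq_bigr => K _ do rewrite ffunE.
rewrite (sum_ksubset (fun A => (T \subset A) || [disjoint T & A])).
(* As [#|V| = 2 * k], complements of [k]-sets are [k]-sets, so those containing [T] are the
   complements of the members of [D]. *)
have -> : [set A : {set V} | (T \subset A) || [disjoint T & A] & #|A| == k] =
    D :|: [set ~: A | A in D].
  apply/setP => A; rewrite in_setU.
  rewrite -{3}[A]setCK (mem_imset _ _ (@setC_inj V)) !inE.
  have -> : (#|~: A| == k) = (#|A| == k).
    by have := cardsC A; lia.
  by rewrite setCS disjoint_sym -disjoints_subset -andb_orl orbC.
rewrite cardsU (card_imset _ (@setC_inj V)) cardD.
(* A common member and its complement would both miss a point of [T]. *)
suff /eqP -> : D :&: [set ~: A | A in D] == set0 by rewrite cards0; lia.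
rewrite -subset0; apply/subsetP => A; rewrite inE => /andP[].
rewrite inE => /andP[sAT _] /imsetP[B]; rewrite inE => /andP[sBT _] defA.
case/set0Pn: T0 => x xT; have := subsetP sAT x; have := subsetP sBT x.
by rewrite defA !inE xT; case: (x \in B) => [/(_ isT)|_ /(_ isT)].
Qed.

End Size.

Theorem corollary5 (R : realType) (k t : nat) (lt_tk : (t < k)%N)
    (even_t : ~~ odd t) :
  (m1 R (2 * k) k t <= 2 * 'C(2 * k - t - 1, k))%N /\
  (2 * 'C(2 * k - t - 1, k) = 2 * 'C(2 * k - t - 1, k - t - 1))%N.
Proof.
split; last by rewrite -bin_sub; [congr (2 * 'C(_, _)); lia | lia].
have le_k2k : k <= 2 * k by lia.
have le_t2k : t.+1 <= 2 * k by lia.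
pose T : {set 'I_(2 * k)} := [set widen_ord le_t2k i | i : 'I_t.+1].
have cardT : #|T| = t.+1.
  by rewrite card_imset ?card_ord // => i j /(congr1 val) /= /val_inj.
have sz : bool_size (full_or_disjoint k T) = 2 * 'C(2 * k - t - 1, k).
  rewrite size_full_or_disjoint ?card_ord -?card_gt0 ?cardT //.
  by rewrite -subnDA addn1.
have [_ min_m1] := m1P R t le_k2k.
rewrite -sz; apply: min_m1; apply/andP; split; last first.
  by apply/degree_leW/full_or_disjoint_comb; rewrite ?cardT //= ltnW.
(* The size is positive because [t < k] gives [k <= 2 * k - t - 1]. *)
apply/eqP => f0; have : 0 < bool_size (full_or_disjoint k T).
  by rewrite sz muln_gt0 bin_gt0; lia.
rewrite /bool_size big1 // => K _; move/ffunP/(_ K)/eqP: f0.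
by rewrite !ffunE pnatr_eq0 eqb0 => /negPf ->.
Qed.
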